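(* Let $F\ge 5$ be an integer and let $t\le F$ be a positive integer greater than $2$ such that $F+t$ is even. Let $S$ be a numerical semigroup. Then $S$ is an almost symmetric numerical semigroup with Frobenius number $F$ and type $t-2$ if and only if there exist an almost symmetric numerical semigroup $S'$ with Frobenius number $F$ and type $t$, and an integer $x\in[t-1,m(S')-1]$, such that (a) $S=\{x\}\cup S'$; (b) $-x+(\mathbb{N}\setminus S)\subseteq\mathbb{Z}\setminus S$; (c) $x+\big(\mathrm{PF}(S')\setminus\{x,F-x\}\big)\subseteq S$. In this case, $\mathrm{PF}(S')=\mathrm{PF}(S)\cup\{x,F-x\}$.
   Context: $\mathbb{Z}$ denotes the integers and $\mathbb{N}$ the nonnegative integers. A numerical semigroup is a subset $S\subseteq\mathbb{N}$ closed under addition, containing $0$, with $\mathbb{N}\setminus S$ finite. The Frobenius number $\mathrm{F}(S)$ is the largest integer not in $S$. The multiplicity $m(S)$ is the least positive integer in $S$. A pseudo-Frobenius number of $S$ is an integer $x\in\mathbb{Z}\setminus S$ with $x+s\in S$ for all $s\in S\setminus\{0\}$; the set of these is $\mathrm{PF}(S)$, and the type of $S$ is $\mathrm{t}(S)=\#\mathrm{PF}(S)$. Let $\mathrm{L}(S)=\{x\in\mathbb{N}\setminus S\mid \mathrm{F}(S)-x\notin S\}$ (gaps of the second type). $S$ is almost symmetric if $\mathrm{L}(S)\subseteq\mathrm{PF}(S)$. For an integer $a$ and a set $B\subseteq\mathbb{Z}$, $a+B=\{a+b\mid b\in B\}$.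
   Formalization: The integer x is additionally required to differ from F; without this the claim fails for t = F, S' = {0} ∪ [F+1,∞), x = F, where (a)–(c) hold but S = {0} ∪ [F,∞) has Frobenius number F−1. *)

(* Defs.v *)
From mathcomp Require Import all_boot all_order all_algebra finmap.
From mathcomp Require Import boolp classical_sets functions cardinality.

Set Implicit Arguments.
Unset Strict Implicit.
Unset Printing Implicit Defensive.

Import Order.TTheory GRing.Theory Num.Theory.

Local Open Scope classical_set_scope.
Local Open Scope ring_scope.

(* Semigroups are sets of integers contained in NN, so that their complements
   in Z and in NN are both available without coercions. *)
Definition NN : set int := [set n : int | 0 <= n].

Definition numerical_semigroup (S : set int) : Prop :=
  [/\ S `<=` NN,
      S 0,
      (forall a b : int, S a -> S b -> S (a + b)) &
      finite_set (NN `\` S)].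

(* In the next two definitions the set passed to xget is a singleton when S is
   a numerical semigroup; the default value 0 is only used for other sets.
   The maximum ranges over all of Z, so frobenius NN = -1. *)
Definition frobenius (S : set int) : int :=
  xget 0 [set f : int | ~ S f /\ forall y : int, ~ S y -> y <= f].

Definition multiplicity (S : set int) : int :=
  xget 0 [set m : int | (0 < m /\ S m) /\
                        forall y : int, 0 < y -> S y -> m <= y].

Definition PF (S : set int) : set int :=
  [set x : int | ~ S x /\ forall s : int, S s -> s <> 0 -> S (x + s)].

(* fset_set sends infinite sets to fset0, but PF S is finite whenever S is a
   numerical semigroup. *)
Definition sgtype (S : set int) : nat := #|` fset_set (PF S)|%fset.

Definition second_type_gaps (S : set int) : set int :=
  [set x : int | (NN `\` S) x /\ ~ S (frobenius S - x)].

Definition almost_symmetric (S : set int) : Prop :=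
  numerical_semigroup S /\ second_type_gaps S `<=` PF S.

Definition translate (a : int) (B : set int) : set int := [set a + b | b in B].

(* Main.v *)
(* The semigroup S' is S with its multiplicity x removed: x < m(S') forces x to
   be the least positive element of S.  Since PF(S) = L(S) U {F} for almost
   symmetric S, everything reduces to L(S') = L(S) U {x, F - x}, and to the fact
   that the gaps counted by L(S) remain pseudo-Frobenius when x is removed or,
   by (c), added back.  The bound t - 1 <= x is t(S) <= m(S) - 1. *)
Require Import Defs.
From mathcomp Require Import all_boot all_order all_algebra finmap zify.
From mathcomp Require Import boolp classical_sets functions cardinality.

Set Implicit Arguments.
Unset Strict Implicit.
Unset Printing Implicit Defensive.

Import Order.TTheory GRing.Theory Num.Theory.

Local Open Scope classical_set_scope.
Local Open Scope ring_scope.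

(** * Frobenius number and multiplicity as an attained maximum and minimum *)

Lemma frobeniusP (S : set int) (F : int) : F <> 0 -> frobenius S = F ->
  ~ S F /\ forall y : int, ~ S y -> y <= F.
Proof.
move=> F0 SF; have [|noF] := pselect
  (exists f, ~ S f /\ forall y : int, ~ S y -> y <= f).
  by move=> /(@xgetPex _ 0 [set f | ~ S f /\ forall y : int, ~ S y -> y <= f]);
    rewrite -[xget _ _]/(frobenius S) SF.
(* Without a maximum, [xget] returns its default 0, which [F <> 0] excludes. *)
by exfalso; apply: F0; rewrite -SF; apply: xgetPN => f Pf; apply: noF; exists f.
Qed.

Lemma frobenius_eq (S : set int) (F : int) :
  ~ S F -> (forall y : int, ~ S y -> y <= F) -> frobenius S = F.
Proof.
move=> nSF leF; apply: xget_unique => // f [nSf lef].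
by apply/eqP; rewrite eq_le leF //= lef.
Qed.

Lemma multiplicityP (S : set int) (m : int) : m <> 0 -> multiplicity S = m ->
  (0 < m /\ S m) /\ forall y : int, 0 < y -> S y -> m <= y.
Proof.
move=> m0 Sm; have [|noM] := pselect
  (exists m, (0 < m /\ S m) /\ forall y : int, 0 < y -> S y -> m <= y).
  move=> /(@xgetPex _ 0 [set m | (0 < m /\ S m) /\
    forall y : int, 0 < y -> S y -> m <= y]).
  by rewrite -[xget _ _]/(multiplicity S) Sm.
by exfalso; apply: m0; rewrite -Sm; apply: xgetPN => f Pf; apply: noM; exists f.
Qed.

Lemma least_positive_exists (S : set int) (s : int) : 0 < s -> S s ->
  exists2 m : int, 0 < m /\ S m & forall y : int, 0 < y -> S y -> m <= y.
Proof.
move=> s0 Ss.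
have ex : exists n : nat, (0 < n)%N && `[< S n%:Z >].
  exists `|s|%N; apply/andP; split; first lia.
  by apply/asboolP; rewrite gez0_abs ?ltW.
case: (ex_minnP ex) => n /andP[n0 /asboolP Sn] minn.
exists n%:Z => // y y0 Sy.
suff /minn : (0 < `|y|)%N && `[< S `|y|%N%:Z >] by lia.
by apply/andP; split; [lia|apply/asboolP; rewrite gez0_abs ?ltW].
Qed.

Lemma multiplicity_eq (S : set int) (m : int) : 0 < m -> S m ->
  (forall y : int, 0 < y -> S y -> m <= y) -> multiplicity S = m.
Proof.
move=> m0 Sm lem; apply: xget_unique => // n [[n0 Sn] len].
by apply/eqP; rewrite eq_le len //= lem.
Qed.

(** * Pseudo-Frobenius numbers and type of a semigroup with Frobenius number [F] *)

Section FixedFrobenius.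
Variables (S : set int) (F : int).
Hypotheses (F0 : 0 <= F) (nS : numerical_semigroup S).
Hypotheses (nSF : ~ S F) (leF : forall y : int, ~ S y -> y <= F).

Lemma gt_frobenius_mem (y : int) : F < y -> S y.
Proof. by move=> Fy; apply: contrapT => /leF; rewrite leNgt Fy. Qed.

Lemma PF_frobenius : PF S F.
Proof.
case: nS => SN _ _ _; split=> // s Ss s0; apply: gt_frobenius_mem.
have : 0 <= s := SN _ Ss; lia.
Qed.

(** Otherwise [F - f] is a nonzero element of [S], and adding it to [f] puts [F] in [S]. *)
Lemma PF_reflect_notin (f : int) : PF S f -> f <> F -> ~ S (F - f).
Proof.
move=> [_ Pf] fF SFf; apply: nSF; rewrite -(subrKC f F).
by apply: Pf => //; lia.
Qed.

(** For [f <> F] the reflection [F - f] is not in [S], hence is at most [F]. *)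
Lemma PF_ge0 (f : int) : PF S f -> 0 <= f.
Proof.
move=> Pf; have [->//|fF] := eqVneq f F.
by have /leF := PF_reflect_notin Pf (elimN eqP fF); lia.
Qed.

(** By reflection every pseudo-Frobenius number other than [F] is a gap of the second type; the
    hypothesis is the converse inclusion. *)
Lemma PF_second_type_gaps :
  second_type_gaps S `<=` PF S -> PF S = second_type_gaps S `|` [set F].
Proof.
move=> LP; rewrite /second_type_gaps (frobenius_eq nSF leF) in LP *.
apply/seteqP; split=> [f Pf|f [/LP//|->]]; last exact: PF_frobenius.
have [->|fF] := eqVneq f F; [by right|left].
split; last exact: PF_reflect_notin (elimN eqP fF).
by split; [exact: PF_ge0|case: Pf].
Qed.

Lemma finite_PF : finite_set (PF S).
Proof.
case: nS => _ _ _; apply: sub_finite_set => f Pf.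
by split; [exact: PF_ge0|case: Pf].
Qed.

(* Distinct pseudo-Frobenius numbers lie in distinct nonzero classes mod m. *)
Lemma sgtype_lt (m : int) : 0 < m -> S m -> (sgtype S)%:Z <= m - 1.
Proof.
case: nS => SN S0 SD _ m0 Sm.
have Smul (k : nat) : S (m *+ k).
  by elim: k => [|k IH]; rewrite ?mulr0n // mulrS; apply: SD.
have inPF f : f \in fset_set (PF S) -> PF S f.
  by rewrite in_fset_set ?inE //; exact: finite_PF.
pose r (f : int) := `|(f %% m)%Z|%N.
have rE (f : int) : (r f)%:Z = (f %% m)%Z.
  by rewrite gez0_abs // modz_ge0 //; lia.
have modlt (f g : int) : (f %% m)%Z = (g %% m)%Z -> f < g ->
    exists2 k : nat, g = f + m *+ k & m *+ k <> 0.
  move=> efg fg; have /dvdzP[q Eq] : (m %| g - f)%Z.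
    by rewrite -eqz_mod_dvd; apply/eqP.
  have q0 : 0 < q by nia.
  exists `|q|%N; rewrite -mulr_natr natz gez0_abs ?ltW //; nia.
suff : (sgtype S <= size (iota 1 (`|m|.-1)))%N by rewrite size_iota; lia.
rewrite /sgtype -(size_map r); apply: uniq_leq_size.
  (* If two of them were congruent, the larger would be the smaller plus a nonzero multiple of [m],
     hence in [S]. *)
  rewrite map_inj_in_uniq ?fset_uniq // => f g /inPF Pf /inPF Pg.
  move/(congr1 Posz); rewrite !rE => efg.
  have [fg|gf|//] := ltgtP f g.
    have [k Eg k0] := modlt _ _ efg fg.
    by case: Pg => []; rewrite Eg; case: Pf => _ /(_ _ (Smul k) k0).
  have [k Ef k0] := modlt _ _ (esym efg) gf.
  by case: Pf => []; rewrite Ef; case: Pg => _ /(_ _ (Smul k) k0).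
move=> _ /mapP[f /inPF Pf ->]; rewrite mem_iota.
have : (r f)%:Z < m by rewrite rE ltz_pmod.
(* Residue 0 would make the nonnegative [f] a multiple of [m], hence an element of [S]; so only
   [m - 1] residues remain. *)
suff : r f <> 0%N by lia.
move=> /(congr1 Posz); rewrite rE => f0; have fge := PF_ge0 Pf.
case: Pf => nSf _; apply: nSf.
have [->//|fn0] := eqVneq f 0.
have [||k -> _] := modlt 0 f; [by rewrite f0 mod0z|by lia|by rewrite add0r].
Qed.

(** With no positive element of [S] up to [F], each of 1, ..., [F] is a gap, and adding a nonzero
    element of [S] takes it beyond [F]. This excludes [F < x] in the theorem. *)
Lemma frobenius_le_sgtype (m : int) : F < m ->
  (forall y : int, 0 < y -> S y -> m <= y) -> F <= (sgtype S)%:Z.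
Proof.
move=> Fm lem; case: nS => SN _ _ _.
suff : (size [seq n%:Z | n <- iota 1 `|F|] <= sgtype S)%N.
  by rewrite size_map size_iota; lia.
apply: uniq_leq_size.
  by rewrite map_inj_uniq ?iota_uniq // => i j [].
move=> _ /mapP[n + ->]; rewrite mem_iota => hn.
rewrite in_fset_set ?inE; last exact: finite_PF.
split=> [Sn|s Ss s0]; first by have := lem n%:Z _ Sn; lia.
apply: gt_frobenius_mem; have : 0 <= s := SN _ Ss.
by move=> s1; have := lem s _ Ss; lia.
Qed.

End FixedFrobenius.

(** * Removing the least positive element [x] *)

Section RemoveLeast.
Variables (S : set int) (x : int).
Hypotheses (nS : numerical_semigroup S) (x0 : 0 < x).
Hypothesis lex : forall y : int, 0 < y -> S y -> x <= y.
Let T := S `\` [set x].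

Lemma setD1_gt (s : int) : T s -> s <> 0 -> x < s.
Proof.
case: nS => SN _ _ _ [Ss /= sx] s0; have : 0 <= s := SN _ Ss.
by move=> s1; have := lex _ Ss; lia.
Qed.

(** Nonzero elements of [T] exceed [x], so their sums never equal [x]. *)
Lemma numerical_semigroupD1 : numerical_semigroup T.
Proof.
case: nS => SN S0 SD finS; split.
- by move=> y [/SN].
- by split=> //=; lia.
- move=> a b Ta Tb; have [->|a0] := eqVneq a 0; first by rewrite add0r.
  have [->|b0] := eqVneq b 0; first by rewrite addr0.
  have := setD1_gt Ta (elimN eqP a0); have := setD1_gt Tb (elimN eqP b0).
  by case: Ta Tb => Sa _ [Sb _] *; split; [exact: SD|move=> /=; lia].
- apply: (@sub_finite_set _ _ ((NN `\` S) `|` [set x])); last first.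
    by rewrite finite_setU.
  move=> y [Ny nTy]; have [->|yx] := eqVneq y x; [by right|left].
  by split=> // Sy; apply: nTy; split=> //; exact/eqP.
Qed.

Variable F : int.
Hypotheses (Sx : S x) (xF : x < F).
Hypotheses (nSF : ~ S F) (leF : forall y : int, ~ S y -> y <= F).

Let F0 : 0 <= F. Proof. exact: ltW (lt_trans x0 xF). Qed.

Lemma frobenius_notinD1 : ~ T F. Proof. by case. Qed.

Lemma frobenius_maxD1 (y : int) : ~ T y -> y <= F.
Proof.
move=> nTy; rewrite leNgt; apply/negP => Fy; apply: nTy.
split; first exact: (gt_frobenius_mem leF).
by move=> E; move: Fy; rewrite E ltNge ltW.
Qed.

(** Membership changes only at [x]. Thus [x] becomes a gap, with [F - x] outside [S] already, and
    the gap [F - x] now has the gap [x] as its reflection. *)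
Lemma second_type_gapsD1 :
  second_type_gaps T = second_type_gaps S `|` [set x; F - x].
Proof.
rewrite /second_type_gaps (frobenius_eq nSF leF).
rewrite (frobenius_eq frobenius_notinD1 frobenius_maxD1).
have [SN _ SD _] := nS.
have nSFx : ~ S (F - x) by move=> /(SD _ _ Sx); rewrite subrKC.
apply/seteqP; split=> y.
  move=> [[Ny nTy] nTFy].
  have [->|yx] := eqVneq y x; first by right; left.
  have [->|yFx] := eqVneq y (F - x); first by right; right.
  left; split; first by split=> // Sy; apply: nTy; split=> //; exact/eqP.
  by move=> SFy; apply: nTFy; split=> //= ?; move/eqP: yFx; apply; lia.
case=> [[[Ny nSy] nSFy]|[->|->]].
- by split; [split=> // -[]|case].
- split; last by case.
  by split; [exact: SN|case=> _; exact].
- split; last by rewrite opprB subrKC => -[_]; exact.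
  by split; [rewrite /NN /=; lia|case].
Qed.

(** Let [s] be a nonzero element of [T], so [x < s]. For [f] in [PF S], nonnegativity gives
    [x < f + s], so the sum avoids [x]; likewise for [x + s]. Finally [F - x + s] exceeds [F]. *)
Lemma sub_PFD1 : PF S `|` [set x; F - x] `<=` PF T.
Proof.
have [SN _ SD _] := nS.
have nSFx : ~ S (F - x) by move=> /(SD _ _ Sx); rewrite subrKC.
move=> f [Pf|[->|->]].
- have f0 := PF_ge0 F0 nSF leF Pf; case: Pf => nSf Pf; split; first by case.
  move=> s Ts s0; have := setD1_gt Ts s0; case: Ts => Ss _ xs.
  by split; [exact: Pf|move=> /=; lia].
- split; first by case=> _; exact.
  move=> s Ts s0; have := setD1_gt Ts s0; case: Ts => Ss _ xs.
  by split; [exact: SD|move=> /=; lia].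
- split; first by case.
  move=> s Ts s0; have := setD1_gt Ts s0; case: Ts => Ss _ xs.
  by split; [apply: (gt_frobenius_mem leF); lia|move=> /=; lia].
Qed.

Lemma almost_symmetricD1 : almost_symmetric S -> almost_symmetric T.
Proof.
move=> [_ LP]; split; first exact: numerical_semigroupD1.
rewrite second_type_gapsD1; apply: subset_trans sub_PFD1.
exact: setSU.
Qed.

(** A second type gap [l] of [S] lies in [PF T], so only [l + x] is left to check. Condition (c)
    covers it: [l = x] or [l = F - x] would put [l] or [F - l] in [S]. *)
Lemma almost_symmetric_setU1 :
  translate x (PF T `\` [set x; F - x]) `<=` S ->
  almost_symmetric T -> almost_symmetric S.
Proof.
move=> Hc [_ LP]; split=> // l Ll.
have PTl : PF T l by apply: LP; rewrite second_type_gapsD1; left.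
have [SN S0 SD finS] := nS.
move: Ll; rewrite /second_type_gaps (frobenius_eq nSF leF) => -[[_ nSl] nSFl].
split=> // s Ss s0; have [->|sx] := eqVneq s x; last first.
  by case: PTl => _ /(_ s) []//; split=> //; exact/eqP.
rewrite addrC; apply: Hc; exists l => //; split=> // -[] /= El.
  by apply: nSl; rewrite El.
by apply: nSFl; rewrite El opprB subrKC.
Qed.

Lemma PF_D1 : almost_symmetric S -> PF T = PF S `|` [set x; F - x].
Proof.
move=> aS; have [nT LT] := almost_symmetricD1 aS.
rewrite (PF_second_type_gaps F0 nT frobenius_notinD1 frobenius_maxD1 LT).
rewrite second_type_gapsD1 (PF_second_type_gaps F0 nS nSF leF (proj2 aS)).
exact: setUAC.
Qed.

(** The numbers [x] and [F - x] are distinct and new: [x] is in [S] but [F - x] is not, and adding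
    [x] to [F - x] gives the gap [F]. *)
Lemma sgtypeD1 : almost_symmetric S -> sgtype T = (sgtype S).+2.
Proof.
move=> aS; have [SN S0 SD _] := nS.
have nSFx : ~ S (F - x) by move=> /(SD _ _ Sx); rewrite subrKC.
have nPx : ~ PF S x by case.
have nPFx : ~ PF S (F - x).
  by case=> _ /(_ x Sx) H; apply: nSF; rewrite -(subrK x F); apply: H; lia.
have xFx : x <> F - x by move=> E; apply: nSFx; rewrite -E.
have fP := finite_PF F0 nS nSF leF.
rewrite /sgtype PF_D1 // setUC -setUA fset_setU1 ?finite_setU //.
rewrite fset_setU1 // !cardfsU1 !inE !in_fset_set //.
rewrite (memNset nPx) (memNset nPFx) (introF eqP xFx) /=.
by rewrite !add1n.
Qed.

End RemoveLeast.

(* The condition x <> F only removes the case t = F, S' = {0} U [F+1, oo), x = F,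
   where (a), (b), (c) hold although S = {0} U [F, oo) has Frobenius number
   F - 1. *)
Theorem theorem17 (F : int) (t : nat) (S : set int)
    (hF : 5 <= F) (ht2 : (2 < t)%N) (htF : t%:Z <= F)
    (heven : (2 %| F + t%:Z)%Z) (hS : numerical_semigroup S) :
  ([/\ almost_symmetric S, frobenius S = F & sgtype S = (t - 2)%N]
   <->
   exists (S' : set int) (x : int),
     [/\ almost_symmetric S', frobenius S' = F & sgtype S' = t] /\
     [/\ t%:Z - 1 <= x, x <= multiplicity S' - 1 & x <> F] /\
     [/\ S = [set x] `|` S',
         translate (- x) (NN `\` S) `<=` ~` S &
         translate x (PF S' `\` [set x; F - x]) `<=` S])
  /\
  (forall (S' : set int) (x : int),
     [/\ almost_symmetric S', frobenius S' = F & sgtype S' = t] ->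
     [/\ t%:Z - 1 <= x, x <= multiplicity S' - 1 & x <> F] ->
     [/\ S = [set x] `|` S',
         translate (- x) (NN `\` S) `<=` ~` S &
         translate x (PF S' `\` [set x; F - x]) `<=` S] ->
     PF S' = PF S `|` [set x; F - x]).
Proof.
have F0 : 0 <= F by lia.
have F0' : F <> 0 by lia.
(* Stated for given [S'] and [x], this yields both the converse implication and the final
   identity. *)
have back (S' : set int) (x : int) :
     [/\ almost_symmetric S', frobenius S' = F & sgtype S' = t] ->
     [/\ t%:Z - 1 <= x, x <= multiplicity S' - 1 & x <> F] ->
     [/\ S = [set x] `|` S',
         translate (- x) (NN `\` S) `<=` ~` S &
         translate x (PF S' `\` [set x; F - x]) `<=` S] ->
     [/\ almost_symmetric S, frobenius S = F, sgtype S = (t - 2)%N &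
     PF S' = PF S `|` [set x; F - x]].
  move=> [aS' FS' tS'] [tx xm xF] [ES _ Hc].
  have [nSF' leF'] := frobeniusP F0' FS'.
  (* The bounds on [x] and [2 < t] make the multiplicity at least 3, so it is not the default 0. *)
  have [|[m0 Sm] lem] := @multiplicityP S' _ _ erefl; first by lia.
  set m := multiplicity S' in xm m0 Sm lem.
  have x0 : 0 < x by lia.
  have nSx' : ~ S' x by move=> /(lem _ x0); lia.
  have xltF : x < F by have := leF' _ nSx'; lia.
  have Sx : S x by rewrite ES; left.
  have nSF : ~ S F by rewrite ES => -[/= ?|//]; apply: xF.
  have leF y : ~ S y -> y <= F.
    by rewrite ES => nSy; apply: leF' => Sy; apply: nSy; right.
  have lex y : 0 < y -> S y -> x <= y.
    by rewrite ES => y0 [->//|/(lem _ y0)]; lia.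
  have ES' : S' = S `\` [set x].
    rewrite ES; apply/seteqP; split=> y.
      by move=> Sy; split; [right|move=> /= Ey; apply: nSx'; rewrite -Ey].
    by move=> [[|//]].
  rewrite ES' in aS' tS' Hc *.
  have aS := almost_symmetric_setU1 hS x0 Sx xltF nSF leF Hc aS'.
  have PE := PF_D1 hS x0 lex Sx xltF nSF leF aS.
  have tE := sgtypeD1 hS x0 lex Sx xltF nSF leF aS.
  by split=> //; [exact: frobenius_eq|rewrite -tS' tE; lia].
split; last by move=> S' x h1 h2 h3; case: (back S' x h1 h2 h3).
split; last by move=> [S' [x [h1 [h2 h3]]]]; case: (back S' x h1 h2 h3).
move=> [aS FS tS].
have [nSF leF] := frobeniusP F0' FS.
(* The witness [x] is the multiplicity of [S]; it exists because [F + 1] is in [S]. *)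
have [||x [x0 Sx] lex] := @least_positive_exists S (F + 1); first by lia.
  by apply: (gt_frobenius_mem leF); lia.
have xF : x < F.
  have [||xF] := ltgtP x F; [by []| |by case: nSF; rewrite -xF].
  (* If [F < x], the type [t - 2] would be at least [F], against [t <= F]. *)
  by move=> /(frobenius_le_sgtype F0 hS nSF leF) /(_ lex); rewrite tS; lia.
have aT := almost_symmetricD1 hS x0 lex Sx xF nSF leF aS.
have tT := sgtypeD1 hS x0 lex Sx xF nSF leF aS.
have PE := PF_D1 hS x0 lex Sx xF nSF leF aS.
have tx := sgtype_lt F0 hS nSF leF x0 Sx.
exists (S `\` [set x]), x; split; [|split].
- split=> //; last by rewrite tT tS; lia.
  by apply: frobenius_eq; [case|exact: frobenius_maxD1].
- split; [by rewrite tS in tx; lia| |by lia].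
  have [||m [m0 Tm] lem] := @least_positive_exists (S `\` [set x]) (F + 1).
  + by lia.
  + by split; [apply: (gt_frobenius_mem leF); lia|move=> /=; lia].
  rewrite (multiplicity_eq m0 Tm lem).
  have := setD1_gt hS x0 lex Tm; lia.
- have [SN S0 SD _] := hS; split.
  + by rewrite setUC setDKU // => _ ->.
  + move=> _ [g [_ nSg] <-] H; apply: nSg.
    by rewrite -(addNKr x g) addrC; apply: SD => //; rewrite opprK.
  + rewrite PE => _ [f [Pf nf] <-]; case: Pf => // -[_ Pf].
    by rewrite addrC; apply: Pf => //; lia.
Qed.
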